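(* Let $E$ be a set endowed with a set $\Gamma$ of word conditions and let $A$ be an $E$-twisted ring (not necessarily commutative). Then the category of $E$-twisted $A$-modules is equivalent (and even isomorphic) to the category of left $A[E]_{\underline\sigma}$-modules.
   Context: $W(E)$ is the free monoid of words (finite sequences, including the empty word $1$) on $E$. A set of word conditions on $E$ is a subset $\Gamma\subset W(E)\times W(E)$; a pair $(u,v)\in\Gamma$ is written ''$u=v$'' and called an $E$-condition. $G(E)$ is the quotient monoid of $W(E)$ by the monoid congruence generated by $\Gamma$. An $E$-twisted ring is a (unital) ring $A$ with ring endomorphisms $\sigma_{A,i}$ ($i\in E$) such that, writing $\sigma_{A,u}=\sigma_{A,i_0}\circ\cdots\circ\sigma_{A,i_{n-1}}$ for $u=i_0\cdots i_{n-1}$ and $\sigma_{A,1}=\mathrm{Id}_A$, one has $\sigma_{A,u}=\sigma_{A,v}$ for every $E$-condition $u=v$. Hence $\sigma_{A,g}$ is well defined for $g\in G(E)$. For a ring endomorphism $\sigma$ of $A$ and a left $A$-module $M$, $\sigma^*M:=A\,{}_{\sigma}\!\otimes_A M$ is extension of scalars along $\sigma$. An $E$-twisted $A$-module is a left $A$-module $M$ with $A$-linear maps $\sigma_{M,i}:\sigma_{A,i}^*M\to M$ ($i\in E$) such that $$\sigma_{M,i_0}\circ\sigma_{A,i_0}^*(\sigma_{M,i_1})\circ\cdots\circ\sigma_{A,i_0\cdots i_{n-1}}^*(\sigma_{M,i_n})=\sigma_{M,j_0}\circ\sigma_{A,j_0}^*(\sigma_{M,j_1})\circ\cdots\circ\sigma_{A,j_0\cdots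 j_{m-1}}^*(\sigma_{M,j_m})$$ for every $E$-condition $i_0\cdots i_n=j_0\cdots j_m$ (the composite attached to the empty word being the identity). A morphism $(M,\underline\sigma_M)\to(N,\underline\sigma_N)$ is an $A$-linear map $u$ with $\sigma_{N,i}\circ\sigma_{A,i}^*(u)=u\circ\sigma_{M,i}$ for all $i\in E$. The $E$-twisted polynomial ring $A[E]_{\underline\sigma}$ is the crossed product of $A$ by $G(E)$: the free left $A$-module with basis $G(E)$, with multiplication $(xg)(yh)=x\,\sigma_{A,g}(y)\,gh$ for $x,y\in A$, $g,h\in G(E)$. *)

(* Defs.v *)
From HB Require Import structures.
From mathcomp Require Import all_boot all_algebra.
From mathcomp Require Import finmap.
From mathcomp.classical Require Import boolp.
From mathcomp.multinomials Require Import monalg.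

Set Implicit Arguments.
Unset Strict Implicit.
Unset Printing Implicit Defensive.

Import GRing.Theory.
Local Open Scope ring_scope.
Local Open Scope quotient_scope.

Record category := Category {
  obj :> Type;
  hom : obj -> obj -> Type;
  idm : forall a, hom a a;
  compm : forall a b c, hom b c -> hom a b -> hom a c;
  compmA : forall a b c d (h : hom c d) (g : hom b c) (f : hom a b),
    compm h (compm g f) = compm (compm h g) f;
  comp1m : forall a b (f : hom a b), compm (idm b) f = f;
  compm1 : forall a b (f : hom a b), compm f (idm a) = f
}.
Arguments idm {c} a : rename.
Arguments compm {c a b c0} : rename.

Record functor (C D : category) := Functor {
  fobj :> C -> D;
  fmap : forall a b : C, hom a b -> hom (fobj a) (fobj b);
  fmap1 : forall a : C, fmap (idm a) = idm (fobj a);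
  fmapM : forall (a b c : C) (g : hom b c) (f : hom a b),
    fmap (compm g f) = compm (fmap g) (fmap f)
}.
Arguments fmap {C D} f {a b} : rename.

Section FunctorOps.
Variables (B C D : category).

Definition functor_id : functor C C :=
  @Functor C C id (fun _ _ f => f) (fun=> erefl) (fun _ _ _ _ _ => erefl).

Variables (G : functor C D) (F : functor B C).

Fact functor_comp1 (a : B) : fmap G (fmap F (idm a)) = idm (G (F a)).
Proof. by rewrite !fmap1. Qed.

Fact functor_compM (a b c : B) (g : hom b c) (f : hom a b) :
  fmap G (fmap F (compm g f)) = compm (fmap G (fmap F g)) (fmap G (fmap F f)).
Proof. by rewrite !fmapM. Qed.

Definition functor_comp : functor B D :=
  @Functor B D (fun a => G (F a)) (fun _ _ f => fmap G (fmap F f))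
    functor_comp1 functor_compM.

End FunctorOps.
Arguments functor_id {C}.

Record natural_iso (C D : category) (F G : functor C D) := NaturalIso {
  niso : forall a : C, hom (F a) (G a);
  nisoV : forall a : C, hom (G a) (F a);
  niso_natural : forall (a b : C) (f : hom a b),
    compm (niso b) (fmap F f) = compm (fmap G f) (niso a);
  nisoK : forall a : C, compm (nisoV a) (niso a) = idm (F a);
  nisoVK : forall a : C, compm (niso a) (nisoV a) = idm (G a)
}.

Definition equivalent_categories (C D : category) : Prop :=
  exists (F : functor C D) (G : functor D C),
    inhabited (natural_iso (functor_comp G F) functor_id) /\
    inhabited (natural_iso (functor_comp F G) functor_id).

Definition isomorphic_categories (C D : category) : Prop :=
  exists (F : functor C D) (G : functor D C),
    functor_comp G F = functor_id /\ functor_comp F G = functor_id.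

Lemma linear_eq (R : pzRingType) (M N : lmodType R) (f g : {linear M -> N}) :
  f =1 g -> f = g.
Proof.
case: f g => [f [[fa] [fs]]] [g [[ga] [gs]]] /= /funext efg.
by subst g; congr (GRing.Linear.Pack (GRing.Linear.Class _ _)); congr (_ _).
Qed.

Section LmodCategory.
Variable R : pzRingType.

Definition linear_id (M : lmodType R) : {linear M -> M} := idfun.
Definition linear_comp (M N P : lmodType R)
  (g : {linear N -> P}) (f : {linear M -> N}) : {linear M -> P} := g \o f.

Definition lmod_category : category.
Proof.
by refine (@Category (lmodType R) (fun M N => {linear M -> N})
  linear_id linear_comp _ _ _) => *; apply: linear_eq.
Defined.

End LmodCategory.

Section MalgLift.
Variables (K : choiceType) (V : zmodType) (f : K -> V).

Definition malg_lift (g : {malg int[K]}) : V :=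
  \sum_(k <- msupp g) f k *~ g@_k.

Lemma malg_liftw (d : {fset K}) (g : {malg int[K]}) :
  fsubset (msupp g) d -> malg_lift g = \sum_(k <- d) f k *~ g@_k.
Proof.
move=> le; apply/big_fset_incl => // k _ /mcoeff_outdom ->.
by rewrite mulr0z.
Qed.

Lemma malg_lift_is_zmod_morphism : zmod_morphism malg_lift.
Proof.
move=> g h; rewrite (malg_liftw (msuppB_le g h)).
rewrite (malg_liftw (fsubsetUl (msupp g) (msupp h))).
rewrite (malg_liftw (fsubsetUr (msupp g) (msupp h))).
by rewrite -sumrB; apply: eq_bigr => k _; rewrite mcoeffB mulrzBr.
Qed.

HB.instance Definition _ :=
  GRing.isZmodMorphism.Build _ _ malg_lift malg_lift_is_zmod_morphism.

Lemma malg_liftU k : malg_lift << k >> = f k.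
Proof. by rewrite (malg_liftw msuppU_le) big_seq_fset1 mcoeffUU. Qed.

End MalgLift.

Section ExtScalars.
Variables (A : pzRingType) (s : A -> A) (M : lmodType A).

(* The subgroup of the free abelian group on A * M by which one divides to    *)
(* get the tensor product of the right A-module A, on which A acts via s, and *)
(* the left A-module M.                                                       *)
Inductive ext_rel : {malg int[(A * M)%type]} -> Prop :=
| ext_rel_addl a b m : ext_rel (<< (a + b, m) >> - << (a, m) >> - << (b, m) >>)
| ext_rel_addr a m n : ext_rel (<< (a, m + n) >> - << (a, m) >> - << (a, n) >>)
| ext_rel_bal a x m : ext_rel (<< (a * s x, m) >> - << (a, x *: m) >>)
| ext_rel0 : ext_rel 0
| ext_relB x y : ext_rel x -> ext_rel y -> ext_rel (x - y).

Definition ext_pred : {pred {malg int[(A * M)%type]}} := fun x => `[< ext_rel x >].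

Fact ext_predP x : reflect (ext_rel x) (x \in ext_pred).
Proof. exact: asboolP. Qed.

Fact ext_pred_zmod_closed : zmod_closed ext_pred.
Proof.
split=> [|x y]; first by apply/ext_predP; exact: ext_rel0.
by move=> /ext_predP hx /ext_predP hy; apply/ext_predP; exact: ext_relB.
Qed.

HB.instance Definition _ :=
  GRing.isZmodClosed.Build _ ext_pred ext_pred_zmod_closed.

(* The extension of scalars s^* M. It is only used for ring endomorphisms s,  *)
(* but the construction makes sense for a bare function, and then             *)
(* ext_scalars ((r \o s) \o t) M and ext_scalars (r \o (s \o t)) M, or        *)
(* ext_scalars (s \o id) M and ext_scalars s M, are convertible.              *)
Definition ext_scalars : Type := Quotient.quot ext_pred.

HB.instance Definition _ := GRing.Zmodule.on ext_scalars.
HB.instance Definition _ :=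
  ZmodQuotient.copy ext_scalars (Quotient.quot ext_pred).

Definition tens (a : A) (m : M) : ext_scalars := \pi << (a, m) >>.

Lemma ext_pi_eq (x y : {malg int[(A * M)%type]}) :
  ext_rel (x - y) -> \pi_ext_scalars x = \pi_ext_scalars y.
Proof. by move=> h; apply/eqP; rewrite -Quotient.idealrBE; apply/ext_predP. Qed.

Lemma ext_piP (x y : {malg int[(A * M)%type]}) :
  \pi_ext_scalars x = \pi_ext_scalars y -> ext_rel (x - y).
Proof. by move/eqP; rewrite -Quotient.idealrBE => /ext_predP. Qed.

Lemma tensDl a b m : tens (a + b) m = tens a m + tens b m.
Proof.
rewrite /tens -raddfD; apply: ext_pi_eq.
by rewrite opprD addrA; exact: ext_rel_addl.
Qed.

Lemma tensDr a m n : tens a (m + n) = tens a m + tens a n.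
Proof.
rewrite /tens -raddfD; apply: ext_pi_eq.
by rewrite opprD addrA; exact: ext_rel_addr.
Qed.

Lemma tens_bal a x m : tens (a * s x) m = tens a (x *: m).
Proof. by apply: ext_pi_eq; exact: ext_rel_bal. Qed.

Lemma ext_scalars_ind (P : ext_scalars -> Prop) :
  P 0 -> (forall x y, P x -> P y -> P (x - y)) -> (forall a m, P (tens a m)) ->
  forall x, P x.
Proof.
move=> P0 PB Pt; elim/quotW => g.
have PN x : P x -> P (- x) by move=> Px; rewrite -sub0r; exact: PB.
have PD x y : P x -> P y -> P (x + y).
  by move=> Px Py; rewrite -[y]opprK; apply: PB => //; exact: PN.
rewrite [g]monalgE raddf_sum; elim/big_ind: _ => //= -[a m] _.
have PM n : P (tens a m *+ n).
  by elim: n => [|n IH]; rewrite ?mulr0n // mulrS; exact: PD.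
have -> : << g@_(a, m) *g (a, m) >> = << (a, m) >> *~ g@_(a, m).
  by rewrite -[in LHS](intz (g@_(a, m))) raddfMz.
rewrite raddfMz -/(tens a m).
case: (g@_(a, m)) => n; first exact: PM.
by rewrite NegzE mulrNz; apply: PN; exact: PM.
Qed.

Section Lift.
Variables (V : zmodType) (f : A -> M -> V).

Record balanced : Prop := Balanced {
  balanced_addl : forall a b m, f (a + b) m = f a m + f b m;
  balanced_addr : forall a m n, f a (m + n) = f a m + f a n;
  balanced_bal : forall a x m, f (a * s x) m = f a (x *: m)
}.

Definition ext_lift (fb : balanced) (x : ext_scalars) : V :=
  malg_lift (fun p => f p.1 p.2) (repr x).

Variable fb : balanced.

Lemma ext_lift_pi x : ext_lift fb (\pi x) = malg_lift (fun p => f p.1 p.2) x.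
Proof.
apply/eqP; rewrite -subr_eq0 -raddfB; apply/eqP.
have : ext_rel (repr (\pi_ext_scalars x) - x) by apply: ext_piP; rewrite reprK.
elim=> {x} [a b m|a m n|a y m||x y _ hx _ hy].
- by rewrite !raddfB /= !malg_liftU /= (balanced_addl fb) addrAC addrK subrr.
- by rewrite !raddfB /= !malg_liftU /= (balanced_addr fb) addrAC addrK subrr.
- by rewrite !raddfB /= !malg_liftU /= (balanced_bal fb) subrr.
- by rewrite raddf0.
- by rewrite raddfB hx hy subrr.
Qed.

Lemma ext_lift_tens a m : ext_lift fb (tens a m) = f a m.
Proof. by rewrite ext_lift_pi malg_liftU. Qed.

Fact ext_lift_is_zmod_morphism : zmod_morphism (ext_lift fb).
Proof.
by elim/quotW=> x; elim/quotW=> y; rewrite -raddfB !ext_lift_pi raddfB.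
Qed.

HB.instance Definition _ :=
  GRing.isZmodMorphism.Build _ _ (ext_lift fb) ext_lift_is_zmod_morphism.

End Lift.

Fact ext_scale_balanced (b : A) : balanced (fun a m => tens (b * a) m).
Proof.
by split=> *; rewrite ?mulrDr ?tensDl ?tensDr ?mulrA ?tens_bal.
Qed.

Definition ext_scale (b : A) : ext_scalars -> ext_scalars :=
  ext_lift (ext_scale_balanced b).

HB.instance Definition _ b :=
  GRing.Additive.copy (ext_scale b) (ext_lift (ext_scale_balanced b)).

Fact ext_scaleE b a m : ext_scale b (tens a m) = tens (b * a) m.
Proof. exact: ext_lift_tens. Qed.

Fact ext_scaleA b c x : ext_scale b (ext_scale c x) = ext_scale (b * c) x.
Proof.
elim/ext_scalars_ind: x => [|x y hx hy|a m]; first by rewrite !raddf0.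
  by rewrite !raddfB /= hx hy.
by rewrite !ext_scaleE mulrA.
Qed.

Fact ext_scale1 : left_id 1 ext_scale.
Proof.
elim/ext_scalars_ind=> [|x y hx hy|a m]; first by rewrite raddf0.
  by rewrite !raddfB /= hx hy.
by rewrite !ext_scaleE mul1r.
Qed.

Fact ext_scaleDr : right_distributive ext_scale +%R.
Proof. by move=> b x y; rewrite raddfD. Qed.

Fact ext_scaleDl x b c : ext_scale (b + c) x = ext_scale b x + ext_scale c x.
Proof.
elim/ext_scalars_ind: x => [|x y hx hy|a m]; first by rewrite !raddf0 addr0.
  by rewrite !raddfB /= hx hy opprD addrACA.
by rewrite !ext_scaleE mulrDl tensDl.
Qed.

HB.instance Definition _ := GRing.Zmodule_isLmodule.Build A ext_scalars
  ext_scaleA ext_scale1 ext_scaleDr (fun x => ext_scaleDl x).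

Lemma scale_tens b a m : b *: tens a m = tens (b * a) m.
Proof. exact: ext_scaleE. Qed.

End ExtScalars.

Section LinearLift.
Variables (A : pzRingType) (s : A -> A) (M N : lmodType A) (g : M -> N).

Record semilinear_via : Prop := SemilinearVia {
  semilinear_add : forall m n, g (m + n) = g m + g n;
  semilinear_scale : forall x m, g (x *: m) = s x *: g m
}.

Variable gs : semilinear_via.

Fact ext_linear_balanced : balanced s (fun a m => a *: g m).
Proof.
split=> *; rewrite ?scalerDl ?(semilinear_add gs) ?scalerDr //.
by rewrite (semilinear_scale gs) scalerA.
Qed.

Definition ext_linear_fun : ext_scalars s M -> N := ext_lift ext_linear_balanced.

HB.instance Definition _ :=
  GRing.Additive.copy ext_linear_fun (ext_lift ext_linear_balanced).

Fact ext_linear_is_scalable : scalable ext_linear_fun.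
Proof.
move=> b; elim/ext_scalars_ind=> [|x y hx hy|a m].
- by rewrite !raddf0.
- by rewrite !raddfB /= hx hy.
- by rewrite scale_tens /ext_linear_fun !ext_lift_tens scalerA.
Qed.

HB.instance Definition _ :=
  GRing.isScalable.Build A (ext_scalars s M) N *:%R ext_linear_fun
    ext_linear_is_scalable.

Definition ext_linear : {linear ext_scalars s M -> N} := ext_linear_fun.

Lemma ext_linearE a m : ext_linear (tens s a m) = a *: g m.
Proof. exact: ext_lift_tens. Qed.

End LinearLift.

Lemma tens1Z (A : pzRingType) (s : A -> A) (M : lmodType A) (x : A) (m : M) :
  tens s 1 (x *: m) = s x *: tens s 1 m.
Proof. by rewrite -tens_bal scale_tens mulr1 mul1r. Qed.

Section ExtMaps.
Variables (A : pzRingType) (s t : A -> A) (M N : lmodType A).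

Fact ext_map_semilinear (u : {linear M -> N}) :
  semilinear_via s (fun m => tens s 1 (u m)).
Proof.
split=> [m n|x m]; first by rewrite raddfD tensDr.
by rewrite linearZ tens1Z.
Qed.

Definition ext_map (u : {linear M -> N}) :
  {linear ext_scalars s M -> ext_scalars s N} :=
  ext_linear (ext_map_semilinear u).

Lemma ext_mapE u a m : ext_map u (tens s a m) = tens s a (u m).
Proof. by rewrite ext_linearE scale_tens mulr1. Qed.

Fact ext_comp_semilinear :
  semilinear_via (s \o t) (fun m : M => tens s 1 (tens t 1 m)).
Proof.
split=> [m n|x m]; first by rewrite !tensDr.
by rewrite !tens1Z.
Qed.

(* The identification of (s \o t)^* M with s^* (t^* M) *)
Definition ext_comp :
  {linear ext_scalars (s \o t) M -> ext_scalars s (ext_scalars t M)} :=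
  ext_linear ext_comp_semilinear.

Lemma ext_compE a m : ext_comp (tens (s \o t) a m) = tens s a (tens t 1 m).
Proof. by rewrite ext_linearE scale_tens mulr1. Qed.

Fact ext_id_semilinear : semilinear_via id (@id M).
Proof. by split. Qed.

(* The identification of id^* M with M *)
Definition ext_id : {linear ext_scalars id M -> M} := ext_linear ext_id_semilinear.

Lemma ext_idE a m : ext_id (tens id a m) = a *: m.
Proof. exact: ext_linearE. Qed.

Definition ext_cast (est : s = t) (x : ext_scalars s M) : ext_scalars t M :=
  ecast r (ext_scalars r M) est x.

Lemma ext_castE est a m : ext_cast est (tens s a m) = tens t a m.
Proof. by rewrite /ext_cast; case: _ / est. Qed.

End ExtMaps.
Arguments ext_map {A} s {M N} u : simpl never.
Arguments ext_comp {A} s t M : simpl never.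
Arguments ext_id {A} M : simpl never.

Definition word_conditions (E : Type) := seq E -> seq E -> Prop.

Section WordMonoid.
Variables (E : Type) (Gamma : word_conditions E).

Inductive word_cong : seq E -> seq E -> Prop :=
| word_cong_cond u v : Gamma u v -> word_cong u v
| word_cong_refl u : word_cong u u
| word_cong_sym u v : word_cong u v -> word_cong v u
| word_cong_trans u v w : word_cong u v -> word_cong v w -> word_cong u w
| word_cong_cat u u' v v' :
    word_cong u u' -> word_cong v v' -> word_cong (u ++ v) (u' ++ v').

Definition word_rel : rel {classic (seq E)} := fun u v => `[< word_cong u v >].

Fact word_rel_equiv : equiv_class_of word_rel.
Proof.
split=> [u|u v|v u w]; first by apply/asboolP; exact: word_cong_refl.
  by apply/asboolP/asboolP; exact: word_cong_sym.
move=> /asboolP uv /asboolP vw; apply/asboolP; exact: word_cong_trans uv vw.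
Qed.

Canonical word_rel_equiv_rel := EquivRelPack word_rel_equiv.
Canonical word_rel_enc := defaultEncModRel word_rel.

Definition word_monoid : Type := {eq_quot word_rel}.

HB.instance Definition _ := Choice.on word_monoid.
HB.instance Definition _ : EqQuotient _ word_rel word_monoid :=
  EqQuotient.on word_monoid.

Definition word_class (u : seq E) : word_monoid :=
  \pi_word_monoid (u : {classic (seq E)}).

Lemma word_classP u v : word_class u = word_class v <-> word_cong u v.
Proof.
rewrite /word_class; split=> [/eqquotP/asboolP//|uv].
by apply/eqquotP/asboolP.
Qed.

Definition word_repr (g : word_monoid) : seq E := repr g.

Lemma word_reprK : cancel word_repr word_class.
Proof. exact: reprK. Qed.

Lemma word_classK u : word_cong (word_repr (word_class u)) u.
Proof. by apply/word_classP; rewrite word_reprK. Qed.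

Definition word_mul (g h : word_monoid) : word_monoid :=
  word_class (word_repr g ++ word_repr h).

Lemma word_mulE u v : word_mul (word_class u) (word_class v) = word_class (u ++ v).
Proof. by apply/word_classP/word_cong_cat; exact: word_classK. Qed.

Fact word_mulA : associative word_mul.
Proof.
move=> g h k; rewrite -(word_reprK g) -(word_reprK h) -(word_reprK k).
by rewrite !word_mulE catA.
Qed.

Fact word_mul1 : left_id (word_class [::]) word_mul.
Proof. by move=> g; rewrite -(word_reprK g) word_mulE. Qed.

Fact word_mulr1 : right_id (word_class [::]) word_mul.
Proof. by move=> g; rewrite -(word_reprK g) word_mulE cats0. Qed.

HB.instance Definition _ :=
  isMonoid.Build word_monoid word_mulA word_mul1 word_mulr1.

End WordMonoid.

Section SigmaWord.
Variables (E : Type) (A : pzRingType) (sigma : E -> {rmorphism A -> A}).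

Definition sigma_word (w : seq E) : A -> A :=
  foldr (fun i f => sigma i \o f) id w.

Fact sigma_word_is_zmod_morphism w : zmod_morphism (sigma_word w).
Proof.
elim: w => //= i w IH x y.
by rewrite -raddfB; congr (sigma i _); exact: IH.
Qed.

Fact sigma_word_is_monoid_morphism w : monoid_morphism (sigma_word w).
Proof.
split; elim: w => //= i w IH.
  by rewrite -[RHS](rmorph1 (sigma i)); congr (sigma i _); exact: IH.
by move=> x y; rewrite -rmorphM; congr (sigma i _); exact: IH.
Qed.

HB.instance Definition _ w :=
  GRing.isZmodMorphism.Build A A (sigma_word w) (sigma_word_is_zmod_morphism w).
HB.instance Definition _ w :=
  GRing.isMonoidMorphism.Build A A (sigma_word w)
    (sigma_word_is_monoid_morphism w).

Lemma sigma_word_cat u v : sigma_word (u ++ v) = sigma_word u \o sigma_word v.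
Proof. by elim: u => //= i u ->. Qed.

End SigmaWord.

Record twistedRing (E : Type) (Gamma : word_conditions E) := TwistedRing {
  tring :> pzRingType;
  tsigma : E -> {rmorphism tring -> tring};
  tsigma_cond : forall u v, Gamma u v -> sigma_word tsigma u = sigma_word tsigma v
}.
Arguments tsigma_cond {E Gamma} A {u v} uv : rename.

Section TwistedModules.
Variables (E : Type) (Gamma : word_conditions E) (A : twistedRing Gamma).
Local Notation sigma := (tsigma A).

Section WordMap.
Variables (M : lmodType A) (phi : forall i, {linear ext_scalars (sigma i) M -> M}).

(* For w = i_0 ... i_n and s = id, the composite of the maps                  *)
(* (sigma_{i_0 ... i_{k-1}})^* (phi i_k), where k = 0, ..., n, each preceded  *)
(* by the identification (r \o sigma i_k)^* M = r^* ((sigma i_k)^* M) with    *)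
(* r = sigma_{i_0 ... i_{k-1}}.                                               *)
Fixpoint word_map_from (s : A -> A) (w : seq E) :
    ext_scalars (s \o sigma_word sigma w) M -> ext_scalars s M :=
  match w return ext_scalars (s \o sigma_word sigma w) M -> ext_scalars s M with
  | [::] => id
  | i :: w' => ext_map s (phi i) \o ext_comp s (sigma i) M
                 \o @word_map_from (s \o sigma i) w'
  end.

Definition word_map (w : seq E) : ext_scalars (sigma_word sigma w) M -> M :=
  ext_id M \o @word_map_from id w.

End WordMap.
Arguments word_map_from {M} phi s w.
Arguments word_map {M} phi w.

(* The composites attached to u and v have sources (sigma_u)^* M and          *)
(* (sigma_v)^* M, which are equal because sigma_u = sigma_v.                  *)
Record twistedModule := TwistedModule {
  tmod :> lmodType A;
  tmap : forall i, {linear ext_scalars (sigma i) tmod -> tmod};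
  tmap_cond : forall u v (uv : Gamma u v),
    word_map tmap u =1 word_map tmap v \o ext_cast (tsigma_cond A uv)
}.

Record twistedHom (M N : twistedModule) := TwistedHom {
  thom :> {linear M -> N};
  thom_comm : forall i, tmap N i \o ext_map (sigma i) thom =1 thom \o tmap M i
}.

Arguments thom_comm {M N} f i x : rename.

Lemma twistedHom_eq (M N : twistedModule) (f g : twistedHom M N) :
  thom f =1 thom g -> f = g.
Proof.
case: f g => [f fc] [g gc] /= /linear_eq efg; subst g.
by congr TwistedHom; exact: Prop_irrelevance.
Qed.

Lemma ext_map_id (s : A -> A) (M : lmodType A) :
  ext_map s (linear_id M) =1 id.
Proof.
elim/ext_scalars_ind=> [|x y hx hy|a m]; first by rewrite linear0.
  by rewrite linearB hx hy.
by rewrite ext_mapE.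
Qed.

Lemma ext_map_comp (s : A -> A) (M N P : lmodType A)
    (g : {linear N -> P}) (f : {linear M -> N}) :
  ext_map s (linear_comp g f) =1 ext_map s g \o ext_map s f.
Proof.
elim/ext_scalars_ind=> [|x y hx hy|a m]; first by rewrite !linear0.
  by rewrite !linearB hx hy.
by rewrite [RHS](congr1 (ext_map s g) (ext_mapE s f a m)) !ext_mapE.
Qed.

Fact twistedHom_id_comm (M : twistedModule) i :
  tmap M i \o ext_map (sigma i) (linear_id M) =1 linear_id M \o tmap M i.
Proof. by move=> x /=; rewrite ext_map_id. Qed.

Definition twistedHom_id M : twistedHom M M :=
  TwistedHom (@twistedHom_id_comm M).

Fact twistedHom_comp_comm (M N P : twistedModule)
    (g : twistedHom N P) (f : twistedHom M N) i :
  tmap P i \o ext_map (sigma i) (linear_comp g f) =1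
  linear_comp g f \o tmap M i.
Proof.
move=> x /=; rewrite ext_map_comp /=.
rewrite [LHS](thom_comm g i (ext_map (sigma i) f x)).
by congr (thom g _); exact: thom_comm.
Qed.

Definition twistedHom_comp M N P (g : twistedHom N P) (f : twistedHom M N) :
  twistedHom M P := TwistedHom (twistedHom_comp_comm g f).

Definition twisted_category : category.
Proof.
by refine (@Category twistedModule twistedHom
  twistedHom_id twistedHom_comp _ _ _) => *; apply: twistedHom_eq.
Defined.

End TwistedModules.
Arguments word_map_from {E Gamma A M} phi s w.
Arguments word_map {E Gamma A M} phi w.
Arguments tmap {E Gamma A} t i : rename.
Arguments thom_comm {E Gamma A M N} f i x : rename.

Section TwistedPoly.
Variables (E : Type) (Gamma : word_conditions E) (A : twistedRing Gamma).
Local Notation G := (word_monoid Gamma).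

Lemma sigma_word_cong u v :
  word_cong Gamma u v -> sigma_word (tsigma A) u = sigma_word (tsigma A) v.
Proof.
elim=> {u v} [u v|//|u v _ -> //|u v w _ -> _ -> //|u u' v v' _ eu _ ev].
  exact: tsigma_cond.
by rewrite !sigma_word_cat eu ev.
Qed.

Definition sigma_class (g : G) : A -> A := sigma_word (tsigma A) (word_repr g).

HB.instance Definition _ g := GRing.RMorphism.on (sigma_class g).

Lemma sigma_classE u :
  sigma_class (word_class Gamma u) = sigma_word (tsigma A) u.
Proof. exact/sigma_word_cong/word_classK. Qed.

Lemma sigma_class1 : sigma_class 1%g = id.
Proof. exact: sigma_classE. Qed.

Lemma sigma_classM g h : sigma_class (g * h)%g = sigma_class g \o sigma_class h.
Proof. by rewrite -sigma_word_cat; exact: sigma_classE. Qed.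

(* << x *g g >> is the element x g of the crossed product. *)
Definition twisted_poly : Type := {malg A[G]}.

HB.instance Definition _ := GRing.Zmodule.on twisted_poly.

Implicit Types p q r : twisted_poly.

Definition twisted_mul p q : twisted_poly :=
  \sum_(g <- msupp p) \sum_(h <- msupp q)
    << p@_g * sigma_class g q@_h *g (g * h)%g >>.

Fact twisted_mulw (d1 d2 : {fset G}) p q :
    fsubset (msupp p) d1 -> fsubset (msupp q) d2 ->
  twisted_mul p q = \sum_(g <- d1) \sum_(h <- d2)
    << p@_g * sigma_class g q@_h *g (g * h)%g >>.
Proof.
move=> le1 le2; rewrite /twisted_mul (big_fset_incl _ le1) /=.
  apply/eq_bigr=> g _; apply/big_fset_incl => // h _ /mcoeff_outdom ->.
  by rewrite raddf0 mulr0 monalgU0.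
move=> g _ /mcoeff_outdom pg.
by rewrite big1 => // h _; rewrite pg mul0r monalgU0.
Qed.

Fact twisted_mulDl : left_distributive twisted_mul +%R.
Proof.
move=> p q r; have le := fsubset_refl (msupp r).
rewrite (twisted_mulw (msuppD_le p q) le).
rewrite (twisted_mulw (fsubsetUl (msupp p) (msupp q)) le).
rewrite (twisted_mulw (fsubsetUr (msupp p) (msupp q)) le).
rewrite -big_split /=; apply/eq_bigr=> g _.
rewrite -big_split /=; apply/eq_bigr=> h _.
by rewrite mcoeffD mulrDl monalgUD.
Qed.

Fact twisted_mulDr : right_distributive twisted_mul +%R.
Proof.
move=> r p q; have le := fsubset_refl (msupp r).
rewrite (twisted_mulw le (msuppD_le p q)).
rewrite (twisted_mulw le (fsubsetUl (msupp p) (msupp q))).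
rewrite (twisted_mulw le (fsubsetUr (msupp p) (msupp q))).
rewrite -big_split /=; apply/eq_bigr=> g _.
rewrite -big_split /=; apply/eq_bigr=> h _.
by rewrite mcoeffD raddfD mulrDr monalgUD.
Qed.

Fact twisted_mul0 p : twisted_mul 0 p = 0.
Proof. by rewrite /twisted_mul msupp0 big_seq_fset0. Qed.

Fact twisted_mulr0 p : twisted_mul p 0 = 0.
Proof.
by rewrite /twisted_mul; apply: big1 => g _; rewrite msupp0 big_seq_fset0.
Qed.

Lemma twisted_mulUU (x y : A) (g h : G) :
  twisted_mul << x *g g >> << y *g h >> =
  << x * sigma_class g y *g (g * h)%g >>.
Proof. by rewrite (twisted_mulw msuppU_le msuppU_le) !big_seq_fset1 !mcoeffUU. Qed.

Fact twisted_poly_ind (P : twisted_poly -> Prop) :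
  P 0 -> (forall p q, P p -> P q -> P (p + q)) ->
  (forall x g, P << x *g g >>) -> forall p, P p.
Proof. by move=> P0 PD PU p; rewrite [p]monalgE; elim/big_ind: _. Qed.

Fact twisted_mulA : associative twisted_mul.
Proof.
move=> p q r; elim/twisted_poly_ind: p => [|p p' hp hp'|x g].
- by rewrite !twisted_mul0.
- by rewrite !twisted_mulDl hp hp'.
elim/twisted_poly_ind: q => [|q q' hq hq'|y h].
- by rewrite twisted_mulr0 !twisted_mul0 twisted_mulr0.
- by rewrite !(twisted_mulDl, twisted_mulDr) hq hq'.
elim/twisted_poly_ind: r => [|r r' hr hr'|z k].
- by rewrite !twisted_mulr0.
- by rewrite !twisted_mulDr hr hr'.
by rewrite !twisted_mulUU rmorphM sigma_classM mulrA mulgA.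
Qed.

Definition twisted_one : twisted_poly := << 1 *g 1%g >>.

Fact twisted_mul1 : left_id twisted_one twisted_mul.
Proof.
elim/twisted_poly_ind=> [|p q hp hq|x g]; first exact: twisted_mulr0.
  by rewrite twisted_mulDr hp hq.
by rewrite twisted_mulUU sigma_class1 mul1r mul1g.
Qed.

Fact twisted_mulr1 : right_id twisted_one twisted_mul.
Proof.
elim/twisted_poly_ind=> [|p q hp hq|x g]; first exact: twisted_mul0.
  by rewrite twisted_mulDl hp hq.
by rewrite twisted_mulUU rmorph1 mulr1 mulg1.
Qed.

HB.instance Definition _ := GRing.Zmodule_isPzRing.Build twisted_poly
  twisted_mulA twisted_mul1 twisted_mulr1 twisted_mulDl twisted_mulDr.

End TwistedPoly.

(* Main.v *)
From HB Require Import structures.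
From mathcomp Require Import all_boot all_algebra finmap.
From mathcomp.classical Require Import boolp.
From mathcomp.multinomials Require Import monalg.
Require Import Defs.

(** By the universal property of extension of scalars, an A-linear map
    phi_i from the extension of M along sigma_i to M is the same as a
    sigma_i-semilinear endomorphism s_i of M, where s_i m = phi_i (1 (x) m) and
    phi_i (a (x) m) = a s_i m ([letter_act]).  Under this dictionary the
    composite attached to a word w = i_0 ... i_n sends a (x) m to
    a s_{i_0} (... (s_{i_n} m)) ([word_mapE]), so that the relation imposed by
    a condition u = v just says s_u = s_v ([word_mapP]).  A twisted module is
    therefore an A-module with a semilinear action of the monoid G(E), and a
    morphism is an A-linear map that commutes with this action.

    A module over the twisted polynomial ring is the same data: the action is
    recovered as (sum_g a_g g) m = sum_g a_g s_g m, which is associative because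
    the multiplication rule (x g) (y h) = x sigma_g(y) g h is exactly the
    semilinearity of s_g ([poly_actA]); conversely one restricts scalars along
    a |-> a 1 and lets the letter i act by the basis element of its class.

    Neither construction changes the underlying additive group or the
    underlying functions of the morphisms, so both composites are equal to the
    identity functors, and not merely isomorphic to them.  What this equality of
    functors takes is that module structures on one and the same group are equal
    as soon as their scalings agree ([lmod_of_eq], [twistedModule_eq]), and that
    the morphism induced by an equality between two such objects is the identity
    map on elements.  Equivalence of the categories is then immediate. *)

Set Implicit Arguments.
Unset Strict Implicit.
Unset Printing Implicit Defensive.

Import GRing.Theory.
Local Open Scope ring_scope.

(** * Equality of functors *)

Section Functors.

Definition hom_of_eq (C : category) (a b : C) (e : a = b) : hom a b :=
  ecast c (hom a c) e (idm a).

(** Equality of the maps on morphisms would only typecheck after transport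
    along the equalities of objects; naturality of the induced isomorphisms
    says the same thing without transporting morphisms. *)
Lemma functor_eq_id (C : category) (H : functor C C) (e : forall a, H a = a) :
  (forall (a b : C) (f : hom a b),
     compm (hom_of_eq (e b)) (fmap H f) = compm f (hom_of_eq (e a))) ->
  H = functor_id.
Proof.
case: H e => ob fm fm1 fmM /= e.
have eob : ob = id by apply/funext.
subst ob => natH.
have efm : fm = (fun _ _ f => f).
  apply/functional_extensionality_dep => a.
  apply/functional_extensionality_dep => b.
  apply/functional_extensionality_dep => f.
  have := natH a b f.
  by rewrite (Prop_irrelevance (e a) erefl) (Prop_irrelevance (e b) erefl)
             /hom_of_eq /= comp1m compm1.
subst fm.
by congr Functor; apply: Prop_irrelevance.
Qed.

Definition natural_iso_refl (C D : category) (F : functor C D) : natural_iso F F.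
Proof.
by exists (fun a => idm (F a)) (fun a => idm (F a)) => *; rewrite ?comp1m ?compm1.
Defined.

Lemma isomorphic_equivalent (C D : category) :
  isomorphic_categories C D -> equivalent_categories C D.
Proof.
move=> [F [G [GF FG]]]; exists F, G; rewrite GF FG.
by split; constructor; exact: natural_iso_refl.
Qed.

End Functors.

(** * Module structures on a fixed abelian group *)

Section Lmod.
Variable R : pzRingType.

(** The right-hand side only depends on an equality between types; when both
    types are the same it can be replaced by [erefl], even though M and N are
    different expressions. *)
Lemma lmod_hom_of_eqE (M N : lmod_category R) (e : M = N) (x : M) :
  (hom_of_eq e : {linear M -> N}) x = ecast T T (congr1 (@GRing.Lmodule.sort R) e) x.
Proof. by case: _ / e. Qed.

(** A bundle of the operation with its laws, so that [lmod_of] can put a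
    second module structure on the group V while keeping all the rest of the
    structure of V, in particular its choice of equality test and of choice
    operator: otherwise no equality of objects could hold. *)
Record scaling (V : zmodType) := Scaling {
  scl :> R -> V -> V;
  scl_mul : forall a b v, scl a (scl b v) = scl (a * b) v;
  scl_one : left_id 1 scl;
  scl_addr : right_distributive scl +%R;
  scl_addl : forall v, {morph scl^~ v : a b / a + b}
}.

Definition lmod_carrier (V : zmodType) (s : scaling V) : Type := V.

HB.instance Definition _ V s := GRing.Zmodule.on (@lmod_carrier V s).
HB.instance Definition _ V s := GRing.Zmodule_isLmodule.Build R (@lmod_carrier V s)
  (scl_mul s) (scl_one s) (scl_addr s) (scl_addl s).

Definition lmod_of (V : zmodType) (s : scaling V) : lmodType R := lmod_carrier s.

Lemma lmod_of_eq (N : lmodType R) (s : scaling N) :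
  (forall a (x : N), s a x = a *: x) -> lmod_of s = N.
Proof.
case: N s => T [c1 c2 c3 c4 c5 c6 c7 c8 c9 [sc p1 p2 p3 p4 p5]] [sc' q1 q2 q3 q4] /= h.
have e : sc' = sc.
  by apply/funext => a; apply/funext => x; exact: h.
subst sc'.
rewrite /lmod_of /=.
congr (GRing.Lmodule.Pack (GRing.Lmodule.Class _ _)).
congr GRing.Nmodule_isLSemiModule.Axioms_; exact: Prop_irrelevance.
Qed.

End Lmod.

(** * Twisted modules as semilinear actions *)

Lemma ext_linear_ext (A : pzRingType) (s : A -> A) (M N : lmodType A)
    (f g : {linear ext_scalars s M -> N}) :
  (forall m, f (tens s 1 m) = g (tens s 1 m)) -> f =1 g.
Proof.
move=> fg; elim/ext_scalars_ind=> [|x y hx hy|a m]; first by rewrite !linear0.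
  by rewrite !linearB hx hy.
by rewrite -[a]mulr1 -scale_tens !linearZ fg.
Qed.

Section Twisted.
Variables (E : Type) (Gamma : word_conditions E) (A : twistedRing Gamma).
Local Notation sigma := (tsigma A).

Section WordAction.
Variables (M : lmodType A) (phi : forall i, {linear ext_scalars (sigma i) M -> M}).

Definition letter_act (i : E) (m : M) : M := phi i (tens (sigma i) 1 m).

Lemma letter_actE i a m : phi i (tens (sigma i) a m) = a *: letter_act i m.
Proof. by rewrite -linearZ scale_tens mulr1. Qed.

Definition word_act (w : seq E) : M -> M :=
  foldr (fun i f => letter_act i \o f) id w.

Lemma word_act_cat u v : word_act (u ++ v) = word_act u \o word_act v.
Proof. by elim: u => //= i u ->. Qed.

Lemma word_act_semilinear w : semilinear_via (sigma_word sigma w) (word_act w).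
Proof.
elim: w => //= i w [wD wZ].
split=> [m n|x m] /=; first by rewrite wD /letter_act tensDr linearD.
by rewrite wZ /letter_act tens1Z linearZ.
Qed.

(** This is the definition, kept as a rewriting rule because simplification
    would also unfold the linear maps [ext_map] and [ext_comp]. *)
Lemma word_map_from_cons s i w x : word_map_from phi s (i :: w) x =
  ext_map s (phi i) (ext_comp s (sigma i) M (word_map_from phi (s \o sigma i) w x)).
Proof. by []. Qed.

(** The composites are bare functions, so their additivity, needed to reduce
    equalities between them to pure tensors, is not inferred. *)
Lemma word_map_fromB s w : {morph word_map_from phi s w : x y / x - y}.
Proof.
elim: w s => [//|i w IH] s x y.
by rewrite !word_map_from_cons [word_map_from _ _ _ _](IH (s \o sigma i)) !linearB.
Qed.

(** Each letter i turns a (x) (1 (x) m) into a (x) s_i m, leaving the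
    coefficient in place; the twist s varies because the induction hypothesis
    for the tail of the word is used at the composite of s and sigma_i. *)
Lemma word_map_fromE s w a m :
  word_map_from phi s w (tens _ a m) = tens s a (word_act w m).
Proof.
elim: w s => [//|i w IH] s.
rewrite word_map_from_cons [word_map_from _ _ _ _](IH (s \o sigma i)).
by rewrite ext_compE ext_mapE.
Qed.

Lemma word_mapE w a m : word_map phi w (tens _ a m) = a *: word_act w m.
Proof. by rewrite /word_map /= [X in ext_id _ X]word_map_fromE ext_idE. Qed.

Lemma word_mapB w : {morph word_map phi w : x y / x - y}.
Proof.
by move=> x y; rewrite /word_map /= [X in ext_id _ X]word_map_fromB linearB.
Qed.

Lemma ext_castB (s t : A -> A) (e : s = t) :
  {morph @ext_cast A s t M e : x y / x - y}.
Proof. by case: _ / e. Qed.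

(** On the pure tensor 1 (x) m the two composites are [word_act] of u and v, and
    additive maps are determined by their values on pure tensors. *)
Lemma word_mapP u v (e : sigma_word sigma u = sigma_word sigma v) :
  word_map phi u =1 word_map phi v \o ext_cast e <-> word_act u =1 word_act v.
Proof.
split=> [h m|h].
  have /= := h (tens _ 1 m).
  by rewrite ext_castE !word_mapE !scale1r.
pose d x := word_map phi u x - word_map phi v (ext_cast e x).
suff d0 : forall x, d x = 0 by move=> x; apply/eqP; rewrite -subr_eq0; apply/eqP/d0.
have dB x y : d (x - y) = d x - d y.
  by rewrite /d ext_castB !word_mapB opprD addrACA -opprD.
elim/ext_scalars_ind=> [|x y hx hy|a m].
- by rewrite -(subrr 0) dB subrr.
- by rewrite dB hx hy subrr.
- by rewrite /d ext_castE !word_mapE h subrr.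
Qed.

End WordAction.

(** Only the equality [e] of the underlying modules has to be transported
    along, and only on elements: transporting the structure maps is avoided by
    comparing the semilinear actions that they encode. *)
Lemma twistedModule_eq (M : twistedModule A) (M' : lmodType A)
    (e : M' = M) (phi : forall i, {linear ext_scalars (sigma i) M' -> M'}) phiE :
  let to_M := fun x : M' => ecast T T (congr1 (@GRing.Lmodule.sort A) e) x in
  (forall i x, to_M (letter_act phi i x) = letter_act (tmap M) i (to_M x)) ->
  @TwistedModule _ _ A M' phi phiE = M.
Proof.
case: M e => M psi psiE /= e; subst M' => h.
have e : phi = psi.
  apply/functional_extensionality_dep => i; apply: linear_eq.
  by apply: ext_linear_ext => m; exact: h.
by subst psi; congr TwistedModule; apply: Prop_irrelevance.
Qed.

Lemma thom_hom_of_eqE (M N : twisted_category A) (e : M = N) (x : tmod M) :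
  thom (hom_of_eq e) x =
  ecast T T (congr1 (fun L : twistedModule A => tmod L : Type) e) x.
Proof. by case: _ / e. Qed.

(** * From twisted modules to modules over twisted polynomials *)

Section ToPoly.
Local Notation G := (word_monoid Gamma).
Local Notation P := (twisted_poly A).

Section Obj.
Variable M : twistedModule A.
Implicit Types (m n : M) (p q : P).

(** Words with equal action form a monoid congruence that contains the word
    conditions, hence the congruence that they generate; so G(E) acts. *)
Lemma word_act_cong u v :
  word_cong Gamma u v -> word_act (tmap M) u = word_act (tmap M) v.
Proof.
elim=> {u v} [u v uv|//|u v _ -> //|u v w _ -> _ -> //|u u' v v' _ eu _ ev].
  by apply/funext/(word_mapP _ (tsigma_cond A uv))/tmap_cond.
by rewrite !word_act_cat eu ev.
Qed.

Definition class_act (g : G) : M -> M := word_act (tmap M) (word_repr g).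

Lemma class_actE u : class_act (word_class Gamma u) = word_act (tmap M) u.
Proof. exact/word_act_cong/word_classK. Qed.

Lemma class_act1 : class_act 1%g = id.
Proof. exact: class_actE. Qed.

Lemma class_actM g h : class_act (g * h)%g = class_act g \o class_act h.
Proof. by rewrite -word_act_cat; exact: class_actE. Qed.

Lemma class_act_semilinear g : semilinear_via (sigma_class (A := A) g) (class_act g).
Proof. exact: word_act_semilinear. Qed.

Definition poly_act p m : M := \sum_(g <- msupp p) p@_g *: class_act g m.

(** Freedom to enlarge the support makes sums over different supports
    comparable. *)
Lemma poly_actw (d : {fset G}) p m : fsubset (msupp p) d ->
  poly_act p m = \sum_(g <- d) p@_g *: class_act g m.
Proof.
by move=> le; apply/big_fset_incl => // g _ /mcoeff_outdom ->; rewrite scale0r.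
Qed.

Lemma poly_actDl m : {morph poly_act^~ m : p q / p + q}.
Proof.
move=> p q; rewrite (poly_actw _ (msuppD_le p q)).
rewrite (poly_actw _ (fsubsetUl (msupp p) (msupp q))).
rewrite (poly_actw _ (fsubsetUr (msupp p) (msupp q))).
by rewrite -big_split; apply: eq_bigr => g _; rewrite mcoeffD scalerDl.
Qed.

Lemma poly_actDr : right_distributive poly_act +%R.
Proof.
move=> p m n; rewrite -big_split; apply: eq_bigr => g _.
by rewrite (semilinear_add (class_act_semilinear g)) scalerDr.
Qed.

Lemma poly_actU a g m : poly_act << a *g g >> m = a *: class_act g m.
Proof. by rewrite (poly_actw _ msuppU_le) big_seq_fset1 mcoeffUU. Qed.

Lemma poly_act0 m : poly_act 0 m = 0.
Proof. by rewrite /poly_act msupp0 big_seq_fset0. Qed.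

Lemma poly_act0r p : poly_act p 0 = 0.
Proof. by apply: (addIr (poly_act p 0)); rewrite -poly_actDr !add0r. Qed.

Lemma poly_act1 : left_id 1 poly_act.
Proof. by move=> m; rewrite poly_actU class_act1 scale1r. Qed.

(** By biadditivity it is enough to treat monomials, where
    a s_g (b s_h m) = a sigma_g(b) s_g (s_h m) by semilinearity of s_g. *)
Lemma poly_actA p q m : poly_act p (poly_act q m) = poly_act (p * q) m.
Proof.
elim/twisted_poly_ind: p => [|p p' hp hp'|a g].
- by rewrite mul0r !poly_act0.
- by rewrite mulrDl !poly_actDl hp hp'.
elim/twisted_poly_ind: q => [|q q' hq hq'|b h].
- by rewrite mulr0 poly_act0 poly_act0r.
- by rewrite mulrDr !poly_actDl poly_actDr hq hq'.
rewrite [_ * _]twisted_mulUU !poly_actU (semilinear_scale (class_act_semilinear g)).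
by rewrite scalerA class_actM.
Qed.

Definition poly_scaling : scaling P M :=
  Scaling poly_actA poly_act1 poly_actDr poly_actDl.

Definition poly_module : lmodType P := lmod_of poly_scaling.

Lemma poly_moduleE p (m : poly_module) : p *: m = poly_act p m.
Proof. by []. Qed.

End Obj.

Section Hom.
Variables (M N : twistedModule A) (f : twistedHom M N).

Lemma thom_letter i m : letter_act (tmap N) i (f m) = f (letter_act (tmap M) i m).
Proof. by rewrite /letter_act -(ext_mapE (sigma i) f); exact: thom_comm. Qed.

Lemma thom_word w m : word_act (tmap N) w (f m) = f (word_act (tmap M) w m).
Proof. by elim: w => //= i w ->; exact: thom_letter. Qed.

Definition poly_hom_fun (m : poly_module M) : poly_module N := f m.

Lemma poly_hom_is_zmod_morphism : zmod_morphism poly_hom_fun.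
Proof. exact: (linearB (thom f)). Qed.

Lemma poly_hom_is_scalable : scalable poly_hom_fun.
Proof.
move=> p m; rewrite !poly_moduleE /poly_hom_fun linear_sum.
by apply: eq_bigr => g _; rewrite linearZ /class_act thom_word.
Qed.

HB.instance Definition _ := GRing.isZmodMorphism.Build _ _ poly_hom_fun
  poly_hom_is_zmod_morphism.
HB.instance Definition _ := GRing.isScalable.Build _ _ _ _ poly_hom_fun
  poly_hom_is_scalable.

Definition poly_hom : {linear poly_module M -> poly_module N} := poly_hom_fun.

End Hom.

Definition to_poly : functor (twisted_category A) (lmod_category P).
Proof.
by refine (@Functor (twisted_category A) (lmod_category P) poly_module poly_hom _ _)
  => *; apply: linear_eq.
Defined.

End ToPoly.

(** * From modules over twisted polynomials to twisted modules *)

Section FromPoly.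
Local Notation G := (word_monoid Gamma).
Local Notation P := (twisted_poly A).
Local Notation scalar a := (<< a *g 1%g >> : P).
Local Notation basis g := (<< (1 : A) *g g >> : P).

Section Obj.
Variable N : lmodType P.

Lemma restr_scaleA a b (x : N) : scalar a *: (scalar b *: x) = scalar (a * b) *: x.
Proof. by rewrite scalerA [_ * _]twisted_mulUU sigma_class1 mulg1. Qed.

Lemma restr_scaleDl (x : N) : {morph (fun a => scalar a *: x) : a b / a + b}.
Proof. by move=> a b /=; rewrite monalgUD scalerDl. Qed.

Definition restr_scaling : scaling A N :=
  Scaling restr_scaleA (@scale1r _ _) (fun a => scalerDr (scalar a)) restr_scaleDl.

Definition restr_module : lmodType A := lmod_of restr_scaling.

Lemma restr_moduleE a (x : restr_module) : a *: x = scalar a *: (x : N) :> N.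
Proof. by []. Qed.

(** The commutation rule g a = sigma_g(a) g of the crossed product is what makes
    the basis elements act semilinearly. *)
Lemma basis_scalar g a (x : N) :
  basis g *: (scalar a *: x) = scalar (sigma_class g a) *: (basis g *: x).
Proof.
rewrite !scalerA; congr (_ *: _).
rewrite [LHS]twisted_mulUU [RHS]twisted_mulUU sigma_class1.
by rewrite mulg1 mul1g mul1r mulr1.
Qed.

Definition letter (i : E) : G := word_class Gamma [:: i].

Lemma letter_semilinear i : semilinear_via (sigma i)
  (fun x : restr_module => basis (letter i) *: (x : N) : restr_module).
Proof.
split=> [x y|a x]; first exact: (scalerDr (basis _) (x : N) (y : N)).
by rewrite [LHS]basis_scalar sigma_classE.
Qed.

Definition restr_map i : {linear ext_scalars (sigma i) restr_module -> restr_module} :=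
  ext_linear (letter_semilinear i).

Lemma restr_letter_act i (x : restr_module) :
  letter_act restr_map i x = basis (letter i) *: (x : N).
Proof. by rewrite /letter_act ext_linearE scale1r. Qed.

Lemma restr_word_act w (x : restr_module) :
  word_act restr_map w x = basis (word_class Gamma w) *: (x : N).
Proof.
elim: w => [|i w IH] /=; first by rewrite scale1r.
rewrite restr_letter_act IH scalerA; congr (_ *: _).
rewrite [LHS]twisted_mulUU rmorph1 mulr1.
by rewrite [(_ * _)%g]word_mulE.
Qed.

Lemma restr_map_cond u v (uv : Gamma u v) :
  word_map restr_map u =1 word_map restr_map v \o ext_cast (tsigma_cond A uv).
Proof.
apply/word_mapP => x; rewrite !restr_word_act.
by have /word_classP -> := word_cong_cond uv.
Qed.

Definition restr_twisted : twistedModule A := TwistedModule restr_map_cond.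

End Obj.

Section Hom.
Variables (M N : lmodType P) (f : {linear M -> N}).

Definition restr_hom_fun (x : restr_module M) : restr_module N := f x.

Lemma restr_hom_is_zmod_morphism : zmod_morphism restr_hom_fun.
Proof. exact: (linearB f). Qed.

Lemma restr_hom_is_scalable : scalable restr_hom_fun.
Proof. by move=> a x; exact: (linearZZ f (scalar a) (x : M)). Qed.

HB.instance Definition _ := GRing.isZmodMorphism.Build _ _ restr_hom_fun
  restr_hom_is_zmod_morphism.
HB.instance Definition _ := GRing.isScalable.Build _ _ _ _ restr_hom_fun
  restr_hom_is_scalable.

Definition restr_linear : {linear restr_module M -> restr_module N} := restr_hom_fun.

Lemma restr_hom_comm i :
  restr_map N i \o ext_map (sigma i) restr_linear =1 restr_linear \o restr_map M i.
Proof.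
apply: (ext_linear_ext
  (f := linear_comp (restr_map N i) (ext_map (sigma i) restr_linear))
  (g := linear_comp restr_linear (restr_map M i))) => m.
rewrite [LHS](congr1 (restr_map N i) (ext_mapE _ _ _ _)) [LHS]restr_letter_act.
rewrite [RHS](congr1 restr_linear (restr_letter_act i m)).
exact/esym/(linearZZ f (basis (letter i)) (m : M)).
Qed.

Definition restr_hom : twistedHom (restr_twisted M) (restr_twisted N) :=
  @TwistedHom _ _ _ (restr_twisted M) (restr_twisted N) restr_linear restr_hom_comm.

End Hom.

Definition from_poly : functor (lmod_category P) (twisted_category A).
Proof.
by refine (@Functor (lmod_category P) (twisted_category A) restr_twisted restr_hom _ _)
  => *; apply: twistedHom_eq.
Defined.

(** * The two constructions are mutually inverse *)

(** Both actions are additive in the polynomial, and a monomial a g is the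
    product of the scalar a by the basis element g. *)
Lemma to_from_poly (N : lmodType P) : poly_module (restr_twisted N) = N.
Proof.
apply: lmod_of_eq => p x /=.
elim/twisted_poly_ind: p => [|p q hp hq|a g].
- by rewrite poly_act0 scale0r.
- by rewrite poly_actDl scalerDl hp hq.
rewrite poly_actU /class_act restr_word_act word_reprK restr_moduleE scalerA.
by congr (_ *: _); rewrite [LHS]twisted_mulUU sigma_class1 mulr1 mul1g.
Qed.

Lemma restr_poly (M : twistedModule A) : restr_module (poly_module M) = M.
Proof.
apply: lmod_of_eq => a x /=.
by rewrite [LHS]poly_actU class_act1.
Qed.

(** The basis element of the letter i acts as s_i on the underlying group. *)
Lemma from_to_poly (M : twistedModule A) : restr_twisted (poly_module M) = M.
Proof.
apply: (@twistedModule_eq M _ (restr_poly M) (restr_map (poly_module M))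
  (@restr_map_cond (poly_module M))) => i x.
rewrite !(Prop_irrelevance (congr1 _ (restr_poly M)) (erefl (M : Type))) /=.
by rewrite restr_letter_act [LHS]poly_actU scale1r class_actE.
Qed.

Lemma hom_from_to_polyE (M : twistedModule A) (x : M) :
  (hom_of_eq (C := twisted_category A) (from_to_poly M)
    : twistedHom (restr_twisted (poly_module M)) M) x = x.
Proof.
rewrite thom_hom_of_eqE; move: (congr1 _ _) => e.
by rewrite (Prop_irrelevance e (erefl (M : Type))).
Qed.

Lemma hom_to_from_polyE (N : lmodType P) (x : N) :
  (hom_of_eq (C := lmod_category P) (to_from_poly N)
    : {linear poly_module (restr_twisted N) -> N}) x = x.
Proof.
rewrite lmod_hom_of_eqE; move: (congr1 _ _) => e.
by rewrite (Prop_irrelevance e (erefl (N : Type))).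
Qed.

End FromPoly.
End Twisted.

Theorem proposition2p12 (E : Type) (Gamma : word_conditions E)
    (A : twistedRing Gamma) :
  equivalent_categories (twisted_category A) (lmod_category (twisted_poly A)) /\
  isomorphic_categories (twisted_category A) (lmod_category (twisted_poly A)).
Proof.
suff iso : isomorphic_categories (twisted_category A) (lmod_category (twisted_poly A)).
  by split=> //; exact: isomorphic_equivalent.
exists (to_poly A), (from_poly A); split.
  apply: (functor_eq_id (H := functor_comp (from_poly A) (to_poly A))
    (e := @from_to_poly _ _ A)) => M N f.
  apply: twistedHom_eq => x.
  transitivity (f x); first exact: (hom_from_to_polyE (M := N) (f x)).
  exact/esym/(congr1 f (hom_from_to_polyE (M := M) x)).
apply: (functor_eq_id (H := functor_comp (to_poly A) (from_poly A))
  (e := @to_from_poly _ _ A)) => M N f.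
apply: linear_eq => x.
transitivity (f x); first exact: (hom_to_from_polyE (N := N) (f x)).
exact/esym/(congr1 f (hom_to_from_polyE (N := M) x)).
Qed.
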